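(* Let $m,n$ be integers with $m\geq n\geq 1$ and let $\beta>1$ be the root of $x^2-mx-n$ that is greater than $1$. Then $\mathrm{Fin}(-\beta)$ is closed under addition, i.e. $x+y\in\mathrm{Fin}(-\beta)$ for all $x,y\in\mathrm{Fin}(-\beta)$.
   Context: Ito–Sadahiro $(-\beta)$-expansions. For real $\beta>1$ put $l_\beta=-\frac{\beta}{\beta+1}$, $r_\beta=1+l_\beta=\frac{1}{\beta+1}$, and define $T_{-\beta}:[l_\beta,r_\beta)\to[l_\beta,r_\beta)$ by $T_{-\beta}(y)=-\beta y-\lfloor-\beta y-l_\beta\rfloor$. For $y\in[l_\beta,r_\beta)$ put $d_{-\beta}(y)=y_1y_2y_3\cdots$ where $y_i=\lfloor-\beta T_{-\beta}^{i-1}(y)-l_\beta\rfloor$ for $i\ge1$; then $y=\sum_{i\ge1}y_i(-\beta)^{-i}$. For $x\in\mathbb{R}$, a $(-\beta)$-representation of $x$ is an expression $x=\sum_{i=-\infty}^{k}x_i(-\beta)^i$ with $k\in\mathbb{Z}$ and $x_i\in\mathbb{Z}$. The $(-\beta)$-expansion of $x$ is the $(-\beta)$-representation for which $x_kx_{k-1}x_{k-2}\cdots=d_{-\beta}(y)$ for some $y$ in the open interval $(l_\beta,r_\beta)$; it exists and is unique up to leading zeros. The set $\mathbb{Z}_{-\beta}$ of $(-\beta)$-integers consists of all $x\in\mathbb{R}$ whose $(-\beta)$-expansion has $x_i=0$ for all $i<0$, and $\mathrm{Fin}(-\beta)=\bigcup_{k\in\mathbb{Z}}(-\beta)^k\mathbb{Z}_{-\beta}$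 is the set of numbers with finite $(-\beta)$-expansion. *)

(* Defs.v *)
From HB Require Import structures.
From mathcomp Require Import all_boot all_order all_algebra.
From mathcomp Require Import all_classical all_reals all_analysis.

Set Implicit Arguments.
Unset Strict Implicit.
Unset Printing Implicit Defensive.

Import Order.TTheory GRing.Theory Num.Theory.
Import numFieldNormedType.Exports.

Local Open Scope classical_set_scope.
Local Open Scope ring_scope.

Definition lbeta (R : realType) (beta : R) : R := - (beta / (beta + 1)).

Definition rbeta (R : realType) (beta : R) : R := 1 + lbeta beta.

(* Extended to all of R by the same formula; on [lbeta, rbeta) it takes its
   values in [lbeta, rbeta). *)
Definition Tneg (R : realType) (beta y : R) : R :=
  - beta * y - (Num.floor (- beta * y - lbeta beta))%:~R.

(* 0-indexed: [dneg beta y j] is the digit y_{j+1} of y = sum_i y_i (-beta)^{-i}. *)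
Definition dneg (R : realType) (beta y : R) (j : nat) : int :=
  Num.floor (- beta * iter j (Tneg beta) y - lbeta beta).

(* x = sum_{i <= k} a_i (-beta)^i; the digits above position k, which are not
   part of the representation, are normalised to 0. *)
Definition is_representation (R : realType) (beta x : R) (k : int)
    (a : int -> int) : Prop :=
  (forall i : int, k < i -> a i = 0) /\
  series (fun j : nat => (a (k - j%:Z))%:~R * (- beta) ^ (k - j%:Z)) @ \oo --> x.

Definition is_expansion (R : realType) (beta x : R) (k : int)
    (a : int -> int) : Prop :=
  is_representation beta x k a /\
  exists y : R, lbeta beta < y < rbeta beta /\
    forall j : nat, a (k - j%:Z) = dneg beta y j.

(* Expansions are unique up to leading zeros (a change of k), so [exists] here
   means "the" expansion. *)
Definition beta_integers (R : realType) (beta : R) : set R :=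
  [set x | exists (k : int) (a : int -> int),
     is_expansion beta x k a /\ forall i : int, i < 0 -> a i = 0].

Definition Fin_neg (R : realType) (beta : R) : set R :=
  \bigcup_(k in [set: int])
    [set (- beta) ^ k * z | z in beta_integers beta].

(* Main.v *)
(* Let g = n / beta, so that -g is the algebraic conjugate of beta and the
   digits of a finite expansion, being nonnegative, give a nonnegative conjugate
   sum_i x_i g^i. It is enough to add a single 1 to a finite expansion, since
   Fin(-beta) is invariant under multiplication by -beta and digits are
   nonnegative. Compare the orbits of z = x / (-beta)^k and
   w = (x + 1) / (-beta)^k under the transformation: their difference at step j
   is an element a - b beta of Z[beta], plus the part of the added 1 that is
   still to come. Since the orbits stay in an interval of length 1, the
   difference has absolute value below 1, and this forces a + b g > 0 or
   a = b = 0, up to two transient exceptional states. When the orbit of z has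
   reached 0, the orbit of w lies in Z[beta] with nonnegative conjugates, which
   each further step contracts by the factor g < 1; an element of Z[beta] in
   (-1, 1) with small nonnegative conjugate is 0, so w has a finite expansion. *)
Require Import Defs.
From HB Require Import structures.
From mathcomp Require Import all_boot all_order all_algebra.
From mathcomp Require Import all_classical all_reals all_analysis.
From mathcomp Require Import ring lra zify.

Set Implicit Arguments.
Unset Strict Implicit.
Unset Printing Implicit Defensive.

Import Order.TTheory GRing.Theory Num.Theory.
Import numFieldNormedType.Exports.

Local Open Scope classical_set_scope.
Local Open Scope ring_scope.

(** * Integer inequalities read off from real ones *)

Section IntCast.
Variable R : realType.
Implicit Types a b : int.

Lemma intr_leN1 a : a < 0 -> a%:~R <= -1 :> R.
Proof. by move=> a0; rewrite (_ : -1 = (-1)%:~R) // ler_int; lia. Qed.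

Lemma intr_ge1 a : 0 < a%:~R :> R -> 1 <= a%:~R :> R.
Proof. by rewrite ltr0z (_ : 1 = 1%:~R :> R) // ler_int; lia. Qed.

Lemma int_geN1 a : -2 < a%:~R :> R -> -1 <= a.
Proof. by rewrite (_ : -2 = (-2)%:~R) // ltr_int; lia. Qed.

Lemma int_eqN1 a : -1 <= a -> a < 0 -> a = -1.
Proof. lia. Qed.

Lemma int_le_ltD1 a b : a%:~R < b%:~R + 1 :> R -> a <= b.
Proof. by rewrite (_ : 1 = 1%:~R :> R) // -intrD ltr_int ltzD1. Qed.

End IntCast.

(** * The quadratic base, its conjugate, and one step of the carry automaton *)

Section NegBase.
Variables (R : realType) (m n : int) (beta : R).
Hypotheses (hn : 1 <= n) (hmn : n <= m) (hbeta : 1 < beta).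
Hypothesis hquad : beta ^+ 2 = m%:~R * beta + n%:~R.

(* [- beta] and [g] are the roots of X^2 + m X - n; the Galois conjugate of
   [a - b * beta] is [a + b * g]. *)
Let g : R := n%:~R / beta.

Let hn1 : 1 <= n%:~R :> R. Proof. by have := hn; rewrite -(ler_int R). Qed.
Let hmnR : n%:~R <= m%:~R :> R. Proof. by rewrite ler_int. Qed.
Let b_gt0 : 0 < beta. Proof. exact: lt_trans ltr01 hbeta. Qed.
Let b_neq0 : beta != 0. Proof. by rewrite gt_eqF. Qed.
Let bV_gt0 : 0 < beta^-1. Proof. by rewrite invr_gt0. Qed.

Lemma conj_mul : g * beta = n%:~R. Proof. by rewrite /g divfK. Qed.

Lemma base_eq : beta = m%:~R + g.
Proof.
apply: (mulIf b_neq0); rewrite mulrDl conj_mul -hquad; ring.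
Qed.

Lemma conj_ge : beta^-1 <= g.
Proof. by rewrite /g ler_peMl // invr_ge0 ltW // (lt_trans ltr01). Qed.

Lemma conj_gt0 : 0 < g.
Proof. by apply: lt_le_trans conj_ge; rewrite invr_gt0. Qed.

Lemma conj_lt1 : g < 1.
Proof.
rewrite /g ltr_pdivrMr // mul1r (le_lt_trans hmnR) //.
by rewrite base_eq ltrDl conj_gt0.
Qed.

Lemma conj_sqr : g ^+ 2 = n%:~R - m%:~R * g.
Proof. by rewrite -conj_mul [in RHS]base_eq; ring. Qed.

(** Here [beta + g = m + 2 g] with [m >= 1] and [g >= beta^-1]. A unit change of [b] alters the gap
    between [a - b * beta] and its conjugate [a + b * g] by [beta + g]. *)
Lemma base_gap : 1 + beta^-1 ^+ 2 < beta + g.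
Proof.
have h0 := bV_gt0; have h1 : beta^-1 < 1 by rewrite invf_lt1.
have h2 : 1 <= m%:~R :> R := le_trans hn1 hmnR.
have h3 : beta^-1 ^+ 2 < beta^-1 by rewrite expr2 gtr_pMl.
by have := base_eq; have := conj_ge; lra.
Qed.

Definition conj_pos (a b : int) := (a = 0 /\ b = 0) \/ 0 < a%:~R + b%:~R * g.

(* The two exceptional states occur because adding 1 at position 0 may produce
   the relation n = (-beta)^2 + m (-beta) in the leading positions before the
   added 1 has been reached; [e] is that pending contribution. *)
Definition carry (a b : int) (e : R) :=
  [\/ conj_pos a b, [/\ a = -1, b = 0 & 0 < e]
    | [/\ a = - m, b = -1 & e < 0]].

(** Here [p] and [q] are the digits of the orbits of [z] and [w], and [c] is the part of the pending
    term that becomes integral. The new conjugate is [g] times the old one plus [c + p - q]; the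
    cases follow the sign of the new coefficient [a - m * b]. *)
Lemma carry_step (a b c p q : int) (e e1 : R) :
  carry a b e -> 0 <= c -> - beta * e = e1 + c%:~R -> c = 0 \/ e1 = 0 ->
  - beta^-1 <= e1 <= beta^-1 ^+ 2 -> 0 <= p -> 0 <= q <= m ->
  -1 < - beta * (a%:~R - b%:~R * beta + e) + p%:~R - q%:~R < 1 ->
  carry (n * b + c + p - q) (a - m * b) e1.
Proof.
move=> hs c0 he hc /andP[el eu] p0 /andP[q0 qm].
have -> : - beta * (a%:~R - b%:~R * beta + e) + p%:~R - q%:~R =
   (n * b + c + p - q)%:~R - (a - m * b)%:~R * beta + e1 :> R.
  rewrite mulrDr he !(intrD, intrB, intrM, intrN, rmorphD, rmorphB, rmorphM).
  transitivity (- beta * a%:~R + b%:~R * beta ^+ 2 + (e1 + c%:~R) + p%:~R - q%:~R : R).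
    by ring.
  by rewrite hquad; ring.
move=> /andP[hl hu].
have g0 := conj_gt0; have g1 := conj_lt1; have bE := base_eq.
have gb := conj_ge; have gap := base_gap.
have bi1 : beta^-1 < 1 by rewrite invf_lt1.
have bi0 := bV_gt0; have b1 := hbeta.
have bi2 : beta^-1 ^+ 2 < 1 by rewrite expr2 mulr_ilt1 // ltW.
case: hs => [hp|[aE bE0 e0]|[aE bE1 e0]].
- have [hb|hb|hb] := ltgtP (a - m * b) 0.
  (* Without [- q] the new conjugate is nonnegative, so [n * b + c + p >= 1]. Then [q <= m],
     [beta = m + g] and [e1 >= - beta^-1 >= - g] push the difference up to at least 1. *)
  + exfalso.
    have hv : 0 <= (n * b + c + p)%:~R + (a - m * b)%:~R * g.
      case: hp => [[-> ->]|hp].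
        rewrite (mulr0 n) (mulr0 m) subr0 (add0r c) mul0r addr0 ler0z.
        exact: addr_ge0.
      have -> : (n * b + c + p)%:~R + (a - m * b)%:~R * g =
         g * (a%:~R + b%:~R * g) + (c + p)%:~R :> R.
        rewrite !(intrD, intrB, intrM).
        transitivity (b%:~R * g ^+ 2 + a%:~R * g + c%:~R + p%:~R : R).
          by rewrite conj_sqr; ring.
        by ring.
      have : 0 <= (c + p)%:~R :> R by rewrite ler0z addr_ge0.
      by move=> ?; rewrite addr_ge0 // mulr_ge0 ?ltW.
    have hbR : (a - m * b)%:~R <= -1 :> R.
      exact: intr_leN1.
    have hA : 1 <= (n * b + c + p)%:~R :> R.
      have : (a - m * b)%:~R * g <= - g :> R by rewrite -(mulN1r g) ler_pM2r.
      move=> ?; have : 0 < (n * b + c + p)%:~R :> R by lra.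
      exact: intr_ge1.
    have : q%:~R <= m%:~R :> R by rewrite ler_int.
    move: hu; rewrite (intrB _ _ q).
    have : (a - m * b)%:~R * beta <= - beta :> R.
      by rewrite -(mulN1r beta) ler_pM2r.
    by lra.
  + constructor 1; right.
    have hbR : 1 <= (a - m * b)%:~R :> R by apply: intr_ge1; rewrite ltr0z.
    have : beta + g <= (a - m * b)%:~R * (beta + g).
      by rewrite ler_peMl // addr_ge0 // ltW.
    by lra.
  + rewrite hb mul0r subr0 in hl hu *.
    set A := (n * b + c + p - q) in hl hu *.
    have [A0|A0|A0] := ltgtP A 0.
    * have AR : A%:~R <= -1 :> R by exact: intr_leN1.
      constructor 2; split=> //; last by lra.
      by apply: int_eqN1 => //; apply: (@int_geN1 R); lra.
    * by constructor 1; right; rewrite mul0r addr0 ltr0z.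
    * by constructor 1; left.
(* From the state [-1], the sign of [e] rules out a carry, and a difference below 1 forces
   [p - q <= - m], the least value that the digits allow. *)
- have cz : c = 0.
    case: hc => // e10; exfalso; move: he; rewrite e10 add0r => he.
    have : 0 <= c%:~R :> R by rewrite ler0z.
    have := mulr_gt0 b_gt0 e0.
    by lra.
  constructor 3.
  rewrite aE bE0 cz !mulr0 subr0 !add0r in hl hu *.
  split=> //; last by move: he; rewrite cz; have := mulr_gt0 b_gt0 e0; lra.
  apply/eqP; rewrite eq_le; apply/andP; split; last first.
    by rewrite -[- m]add0r lerB.
  rewrite -(ler_int R) in qm.
  have : (p - q)%:~R < (- m)%:~R + 1 :> R.
    by move: hu; rewrite !(rmorphN,rmorph1) /=; lra.
  exact: int_le_ltD1.
(* The coefficient of [beta] cancels, so the new state is an integer [A >= -1]; the value [-1] is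
   possible only with [e1 > 0]. *)
- have hb : a - m * b = 0 by rewrite aE bE1 mulrN1 opprK addNr.
  rewrite hb mul0r subr0 in hl hu *.
  set A := (n * b + c + p - q) in hl hu *.
  have : -1 <= A by apply: (@int_geN1 R); lra.
  rewrite le_eqVlt => /orP[/eqP A1|A1].
  + constructor 2; split => //.
    by move: hl; rewrite -A1; lra.
  + constructor 1; have [A0|A0|A0] := ltgtP A 0.
    * by move: A1 A0; clear; lia.
    * by right; rewrite mul0r addr0 ltr0z.
    * by left.
Qed.
End NegBase.

(** * The transformation, its digits, and orbits that reach 0 *)

Section NegTransformation.
Variables (R : realType) (beta : R).
Hypothesis hbeta : 1 < beta.

Let b_gt0 : 0 < beta. Proof. exact: lt_trans ltr01 hbeta. Qed.
Let b_neq0 : beta != 0. Proof. by rewrite gt_eqF. Qed.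

Lemma rbetaE : rbeta beta = (beta + 1)^-1.
Proof.
have b1 : beta + 1 != 0 by rewrite gt_eqF // addr_gt0.
by rewrite /rbeta /lbeta; field.
Qed.

Lemma lbetaE : lbeta beta = - (beta * rbeta beta).
Proof. by rewrite rbetaE. Qed.

Lemma rbeta_gt0 : 0 < rbeta beta.
Proof. by rewrite rbetaE invr_gt0 addr_gt0. Qed.

Lemma lbeta_lt : lbeta beta < - rbeta beta.
Proof. by rewrite lbetaE ltrN2 ltr_pMl // rbeta_gt0. Qed.

Lemma iterTnegS y j :
  iter j.+1 (Tneg beta) y = - beta * iter j (Tneg beta) y - (dneg beta y j)%:~R.
Proof. by []. Qed.

Lemma Tneg_range y : lbeta beta <= Tneg beta y < rbeta beta.
Proof.
rewrite /Tneg /rbeta.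
have := floor_itv (- beta * y - lbeta beta).
rewrite intrD => /andP[h1 h2]; apply/andP; split; lra.
Qed.

Lemma iterTneg_range y j : lbeta beta <= y < rbeta beta ->
  lbeta beta <= iter j (Tneg beta) y < rbeta beta.
Proof. by case: j => // j _; exact: Tneg_range. Qed.

Lemma dneg_ge0 y j : lbeta beta <= y < rbeta beta -> 0 <= dneg beta y j.
Proof.
move=> /(iterTneg_range j)/andP[_ h].
rewrite /dneg floor_ge0 lbetaE opprK mulNr addrC subr_ge0.
by rewrite ler_pM2l // ltW.
Qed.

(** The extreme case is the left endpoint, where [- beta * t - lbeta beta] equals [beta]. *)
Lemma dneg_le_base y j : lbeta beta <= y < rbeta beta ->
  (dneg beta y j)%:~R <= beta.
Proof.
move=> /(iterTneg_range j)/andP[h _].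
apply: le_trans (floor_le _) _; rewrite lbetaE in h *.
move: h; set t := iter _ _ _ => h.
have b1 : beta + 1 != 0 by rewrite gt_eqF // addr_gt0.
have : beta * rbeta beta + rbeta beta = 1 by rewrite rbetaE; field.
move: h; set r := rbeta beta => h hr.
have : beta * - (beta * r) <= beta * t by rewrite ler_pM2l.
have : beta * (beta * r + r) = beta by rewrite hr mulr1.
by lra.
Qed.

Lemma floor_sub_lbeta t : lbeta beta <= t < rbeta beta ->
  Num.floor (t - lbeta beta) = 0.
Proof.
by rewrite /rbeta => /andP[? ?]; apply: floor_def; rewrite add0r; lra.
Qed.

Lemma Tneg_id t y : - beta * y = t -> lbeta beta <= t < rbeta beta ->
  Tneg beta y = t.
Proof. by move=> h /floor_sub_lbeta h0; rewrite /Tneg h h0 subr0. Qed.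

Lemma Tneg0 : Tneg beta 0 = 0.
Proof.
apply: Tneg_id; rewrite ?mulr0 // rbeta_gt0 andbT lbetaE oppr_le0.
by rewrite mulr_ge0 ?ltW ?rbeta_gt0.
Qed.

Lemma iterTneg0 j : iter j (Tneg beta) 0 = 0.
Proof. by elim: j => //= j ->; exact: Tneg0. Qed.

Lemma iterTneg_eq0 y N j : iter N (Tneg beta) y = 0 -> (N <= j)%N ->
  iter j (Tneg beta) y = 0.
Proof. by move=> h /subnK <-; rewrite iterD h iterTneg0. Qed.

Lemma dneg_eq0_tail y N j : iter N (Tneg beta) y = 0 -> (N <= j)%N ->
  dneg beta y j = 0.
Proof.
move=> h Nj; rewrite /dneg (iterTneg_eq0 h Nj) mulr0; apply: floor_sub_lbeta.
rewrite rbeta_gt0 andbT lbetaE oppr_le0.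
by rewrite mulr_ge0 ?ltW ?rbeta_gt0.
Qed.

(** The strict left bound matters: dividing [lbeta beta] by [- beta] gives the excluded point
    [rbeta beta]. This division prepends a leading zero. *)
Lemma range_shift y : lbeta beta < y < rbeta beta ->
  lbeta beta < y / - beta < rbeta beta.
Proof.
move=> /andP[h1 h2].
have : `|y / - beta| < rbeta beta.
  rewrite normrM normrV ?unitfE ?oppr_eq0 // normrN (gtr0_norm b_gt0).
  rewrite ltr_pdivrMr // mulrC ltr_norml -lbetaE h1 /=.
  by rewrite (lt_trans h2) // ltr_pMl // rbeta_gt0.
by rewrite ltr_norml => /andP[h ->]; rewrite (lt_trans lbeta_lt).
Qed.

Lemma Tneg_shift y : lbeta beta < y < rbeta beta -> Tneg beta (y / - beta) = y.
Proof.
move=> /andP[h1 h2]; apply: Tneg_id; last by rewrite ltW.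
by rewrite mulrC divfK // oppr_eq0.
Qed.

Definition finite_orbit y :=
  lbeta beta < y < rbeta beta /\ exists N, iter N (Tneg beta) y = 0.

Lemma finite_orbit_shift y p : finite_orbit y -> finite_orbit (y / (- beta) ^+ p).
Proof.
elim: p y => [|p IH] y h; first by rewrite expr0 divr1.
rewrite exprS invfM mulrA; apply: IH; case: h => h [N hN].
by split; [exact: range_shift | exists N.+1; rewrite iterSr Tneg_shift].
Qed.

(** The extremes occur at [i = 1] and [i = 2], as signs alternate and absolute values decrease. *)
Lemma neg_pow_bounds i : (0 < i)%N ->
  - beta^-1 <= ((- beta) ^+ i)^-1 <= beta^-1 ^+ 2.
Proof.
have u0 : 0 < beta^-1 by rewrite invr_gt0.
have u1 : beta^-1 < 1 by rewrite invf_lt1.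
case: i => // -[_|i _].
  by rewrite expr1 invrN lexx /= (@le_trans _ _ 0) ?oppr_le0 ?exprn_ge0 // ltW.
have : `|((- beta) ^+ i.+2)^-1| <= beta^-1 ^+ 2.
  rewrite normrV ?unitfE ?expf_neq0 ?oppr_eq0 // normrX normrN (gtr0_norm b_gt0).
  by rewrite -exprVn ler_wiXn2l // ltW.
rewrite ler_norml => /andP[h ->]; rewrite andbT; apply: le_trans h.
by rewrite lerN2 expr2 ger_pMl // ltW.
Qed.

Lemma expand_dneg y N :
  y = \sum_(j < N) (dneg beta y j)%:~R / (- beta) ^+ j.+1
      + iter N (Tneg beta) y / (- beta) ^+ N.
Proof.
have nb : - beta != 0 by rewrite oppr_eq0.
elim: N => [|N IH]; first by rewrite big_ord0 add0r divr1.
rewrite {1}IH big_ord_recr iterTnegS -addrA; congr (_ + _).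
have h := expf_neq0 N nb.
by rewrite exprS; field; rewrite h b_neq0.
Qed.

End NegTransformation.

(** * Closure under addition, in terms of orbits *)

Section Addition.
Variables (R : realType) (m n : int) (beta : R).
Hypotheses (hn : 1 <= n) (hmn : n <= m) (hbeta : 1 < beta).
Hypothesis hquad : beta ^+ 2 = m%:~R * beta + n%:~R.

Let g : R := n%:~R / beta.
Let T := Tneg beta.

Let b_neq0 : beta != 0. Proof. by rewrite gt_eqF // (lt_trans ltr01). Qed.
Let g_gt0 : 0 < g. Proof. exact: conj_gt0 hn hbeta. Qed.
Let g_lt1 : g < 1. Proof. exact: conj_lt1 hn hmn hbeta hquad. Qed.

Lemma dneg_le y j : lbeta beta <= y < rbeta beta -> dneg beta y j <= m.
Proof.
move=> /(dneg_le_base hbeta j) h; apply: (@int_le_ltD1 R); apply: le_lt_trans h _.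
by rewrite {1}(base_eq hbeta hquad) ltrD2l.
Qed.

Lemma dneg_itv y j : lbeta beta <= y < rbeta beta -> 0 <= dneg beta y j <= m.
Proof. by move=> h; rewrite dneg_ge0 //= dneg_le. Qed.

Lemma range_sub_itv (s t : R) : lbeta beta <= s < rbeta beta ->
  lbeta beta <= t < rbeta beta -> -1 < s - t < 1.
Proof. by rewrite /rbeta => /andP[? ?] /andP[? ?]; apply/andP; split; lra. Qed.

Lemma range_itv1 (s : R) : lbeta beta <= s < rbeta beta -> -1 < s < 1.
Proof.
have r0 := rbeta_gt0 hbeta; move=> h; rewrite -[s]subr0.
apply: range_sub_itv => //; rewrite r0 andbT ltW //.
by apply: lt_trans (lbeta_lt hbeta) _; rewrite oppr_lt0.
Qed.

(* The part of [w - z = (-beta)^-k], rescaled to step [j], that has not yet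
   reached an integral position; once [k <= j] it is counted in the state. *)
Definition pending k j : R := if (j < k)%N then ((- beta) ^+ (k - j))^-1 else 0.

Lemma pending_le k j : - beta^-1 <= pending k j <= beta^-1 ^+ 2.
Proof.
rewrite /pending; case: ifP => jk; first by rewrite neg_pow_bounds // subn_gt0.
by rewrite oppr_le0 invr_ge0 exprn_ge0 ?invr_ge0 (le_trans ler01) // ltW.
Qed.

(** On reaching step [k] the pending term becomes exactly 1 and passes into the integral state. *)
Lemma pendingS k j :
  - beta * pending k j = pending k j.+1 + (Posz (j.+1 == k))%:~R.
Proof.
have nb : - beta != 0 by rewrite oppr_eq0.
rewrite /pending; have [jk|kj] := ltnP j k; last first.
  by rewrite ltnNge ltnW //= mulr0 add0r gtn_eqF.
have -> : (k - j = (k - j.+1).+1)%N by rewrite -subSn.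
rewrite exprS invfM mulVKf //; have [<-|jk1] := eqVneq j.+1 k.
  by rewrite ltnn subnn expr0 invr1 add0r.
by rewrite ltn_neqAle jk1 jk addr0.
Qed.

Lemma carry_orbit w z k j : (0 < k)%N ->
  lbeta beta <= w < rbeta beta -> lbeta beta <= z < rbeta beta ->
  w - z = ((- beta) ^+ k)^-1 ->
  exists a b : int,
    iter j T w - iter j T z = a%:~R - b%:~R * beta + pending k j /\
    carry m n beta a b (pending k j).
Proof.
move=> k0 hw hz hwz; elim: j => [|j [a [b [IH hc]]]].
  exists 0, 0; split; last by constructor 1; left.
  by rewrite /= mul0r subr0 add0r /pending k0 subn0.
have hstep : iter j.+1 T w - iter j.+1 T z =
   - beta * (a%:~R - b%:~R * beta + pending k j)
   + (dneg beta z j)%:~R - (dneg beta w j)%:~R.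
  by rewrite -IH /T !iterTnegS; ring.
have hr := range_sub_itv (iterTneg_range j.+1 hw) (iterTneg_range j.+1 hz).
have pS := pendingS k j.
exists (n * b + Posz (j.+1 == k) + dneg beta z j - dneg beta w j), (a - m * b).
split.
  rewrite hstep mulrDr pS !(intrD, intrB, intrM, intrN, rmorphD, rmorphB, rmorphM) /=.
  transitivity (- beta * a%:~R + b%:~R * beta ^+ 2
     + (pending k j.+1 + (Posz (j.+1 == k))%:~R)
     + (dneg beta z j)%:~R - (dneg beta w j)%:~R); first by ring.
  by rewrite hquad; ring.
apply: (carry_step hn hmn hbeta hquad hc _ pS); rewrite ?pending_le //.
- have [jk|_] := eqVneq j.+1 k; [right | by left].
  by rewrite /pending -jk ltnn.
- by case/andP: (dneg_itv j hz).
- exact: dneg_itv.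
- by rewrite -hstep.
Qed.

Lemma carry0 a b : carry m n beta a b 0 -> conj_pos n beta a b.
Proof. by case=> // -[_ _]; rewrite ltxx. Qed.

(** A step multiplies the conjugate by [g] and subtracts a nonnegative digit. Positivity is
    [carry_step] with nothing pending and the zero orbit in the role of [z]. *)
Lemma conj_contract y a b p :
  lbeta beta <= y < rbeta beta -> y = a%:~R - b%:~R * beta ->
  conj_pos n beta a b ->
  exists a' b' : int, [/\ iter p T y = a'%:~R - b'%:~R * beta,
    conj_pos n beta a' b' &
    a'%:~R + b'%:~R * g <= g ^+ p * (a%:~R + b%:~R * g)].
Proof.
move=> hy yE hab; elim: p => [|p [a' [b' [IH hc le]]]].
  by exists a, b; split=> //; rewrite expr0 mul1r.
have hstep : iter p.+1 T y =
   - beta * (a'%:~R - b'%:~R * beta + 0) + (0 : int)%:~R - (dneg beta y p)%:~R.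
  by rewrite !addr0 -IH.
have /andP[d0 dm] := dneg_itv p hy.
exists (n * b' + 0 + 0 - dneg beta y p), (a' - m * b'); split.
- rewrite hstep !(intrD, intrB, intrM, intrN, rmorphD, rmorphB, rmorphM) /=.
  transitivity (- beta * a'%:~R + b'%:~R * beta ^+ 2 - (dneg beta y p)%:~R);
    first by ring.
  by rewrite hquad; ring.
- apply/carry0/(@carry_step _ _ _ _ hn hmn hbeta hquad a' b' 0 0 _ 0 0) => //.
  + by constructor 1.
  + by rewrite mulr0 addr0.
  + by left.
  + by rewrite oppr_le0 invr_ge0 exprn_ge0 ?invr_ge0 (le_trans ler01) // ltW.
  + by rewrite d0.
  + by rewrite -hstep; apply: range_itv1; exact: iterTneg_range.
- have -> : (n * b' + 0 + 0 - dneg beta y p)%:~R + (a' - m * b')%:~R * g =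
     g * (a'%:~R + b'%:~R * g) - (dneg beta y p)%:~R :> R.
    rewrite !addr0 !(intrB, intrM).
    transitivity (b'%:~R * g ^+ 2 + a'%:~R * g - (dneg beta y p)%:~R : R).
      have -> : g ^+ 2 = n%:~R - m%:~R * g := conj_sqr hbeta hquad.
      by ring.
    by ring.
  have : 0 <= (dneg beta y p)%:~R :> R by rewrite ler0z.
  have : g * (a'%:~R + b'%:~R * g) <= g * (g ^+ p * (a%:~R + b%:~R * g)).
    by rewrite ler_pM2l.
  by rewrite exprS -mulrA; lra.
Qed.

Lemma exprn_small (q c e : R) : 0 < q -> q < 1 -> 0 < e ->
  exists p : nat, q ^+ p * c < e.
Proof.
move=> q0 q1 e0.
have /cvgrPdist_lt/(_ (e / (`|c| + 1))) : (fun p => q ^+ p) @ \oo --> (0 : R).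
  by apply: cvg_expr; rewrite gtr0_norm.
have c1 : 0 < `|c| + 1 by rewrite ltr_wpDl.
case; first by rewrite divr_gt0.
move=> p _ /(_ p (leqnn p)) /=; rewrite sub0r normrN ltr_pdivlMr // => h.
exists p; apply: le_lt_trans h; rewrite gtr0_norm ?exprn_gt0 //.
rewrite ler_pM2l ?exprn_gt0 //; have := ler_norm c; lra.
Qed.

Lemma conj_pos_orbit y a b : lbeta beta <= y < rbeta beta ->
  y = a%:~R - b%:~R * beta -> conj_pos n beta a b ->
  exists p, iter p T y = 0.
Proof.
move=> hy yE hab.
have gap : 0 < beta + g - 1.
  have := base_gap hn hmn hbeta hquad.
  have : 0 <= beta^-1 ^+ 2 by exact: sqr_ge0.
  by rewrite -/g; lra.
have [p hp] := exprn_small (a%:~R + b%:~R * g) g_gt0 g_lt1 gap.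
have [a' [b' [E hc le]]] := conj_contract p hy yE hab.
exists p.
have /andP[h1 h2] := range_itv1 (iterTneg_range p hy).
have hpos : 0 <= a'%:~R + b'%:~R * g.
  by case: hc => [[-> ->]|/ltW//]; rewrite mul0r addr0.
rewrite -/T E in h1 h2; rewrite E.
have bg0 : 0 < beta + g by lra.
(* The conjugate exceeds the value by [b' * (beta + g)]. With the value in (-1, 1) and the conjugate
   in [0, beta + g - 1), only [b' = 0] remains. *)
have [b0|b0|b0] := ltgtP b' 0.
- have : b'%:~R * (beta + g) <= - (beta + g).
    by rewrite -(mulN1r (beta + g)) ler_pM2r // intr_leN1.
  by lra.
- have : beta + g <= b'%:~R * (beta + g).
    by rewrite ler_peMl ?(ltW bg0) // intr_ge1 // ltr0z.
  by lra.
- move: h1 h2; rewrite b0 mul0r subr0 => h1 h2.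
  suff -> : a' = 0 by [].
  apply/eqP; rewrite eq_le; apply/andP; split.
    by apply: (@int_le_ltD1 R); rewrite add0r.
  apply: (@int_le_ltD1 R); lra.
Qed.

Lemma orbit_eq0_perturb w z k : (0 < k)%N ->
  lbeta beta <= w < rbeta beta -> lbeta beta <= z < rbeta beta ->
  w - z = ((- beta) ^+ k)^-1 -> (exists N, iter N T z = 0) ->
  exists N, iter N T w = 0.
Proof.
move=> k0 hw hz hwz [N hN].
(* By step [N + k] the orbit of [z] is 0 and nothing is pending, so the state describes the orbit of
   [w] alone. *)
have [a [b []]] := carry_orbit (N + k) k0 hw hz hwz.
rewrite (iterTneg_eq0 hbeta hN) ?leq_addr // subr0.
rewrite /pending ltnNge leq_addl /= addr0 => E /carry0 hc.
have [p hp] := conj_pos_orbit (iterTneg_range (N + k) hw) E hc.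
by exists (p + (N + k))%N; rewrite iterD.
Qed.

(** Stands in for [Fin_neg], avoiding digit sequences and limits. *)
Definition finite_exp x :=
  exists k : int, finite_orbit beta (x / (- beta) ^ k).

Let nb_neq0 : - beta != 0. Proof. by rewrite oppr_eq0. Qed.

Lemma finite_expX x i : finite_exp x -> finite_exp (x * (- beta) ^ i).
Proof.
move=> [k hk]; exists (k + i); rewrite expfzDr // invfM mulrACA.
by rewrite mulfV ?expfz_neq0 // mulr1.
Qed.

Lemma finite_exp1D x : finite_exp x -> finite_exp (x + 1).
Proof.
move=> [k hk].
have q0 : 0 < beta^-1 by rewrite invr_gt0 (lt_trans ltr01).
have q1 : beta^-1 < 1 by rewrite invf_lt1 // (lt_trans ltr01).
have [p hp] := exprn_small (`|x + 1|) q0 q1 (rbeta_gt0 hbeta).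
(* [K >= p] puts [(x + 1) / (- beta) ^+ K] in the open interval, [K >= k] allows shifting the orbit
   of [x], and the successor makes [K] positive. *)
pose K := (p + `|k|).+1.
have KE : exists s : nat, Posz K = k + s.
  by exists (`|K%:Z - k|)%N; rewrite /K; lia.
have [s sE] := KE.
have [hz1 hz2] : finite_orbit beta (x / (- beta) ^+ K).
  have -> : x / (- beta) ^+ K = x / (- beta) ^ k / (- beta) ^+ s.
    by rewrite !exprnP sE expfzDr // invfM mulrA.
  exact: finite_orbit_shift.
have hw : lbeta beta < (x + 1) / (- beta) ^+ K < rbeta beta.
  have : `|(x + 1) / (- beta) ^+ K| < rbeta beta.
    have b0 := lt_trans ltr01 hbeta.
    apply: le_lt_trans hp; rewrite normrM normrV ?unitfE ?expf_neq0 //.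
    rewrite normrX normrN (gtr0_norm b0) -exprVn mulrC.
    rewrite ler_wpM2r // ler_wiXn2l ?(ltW q0) ?(ltW q1) //.
    by rewrite /K -addnS leq_addr.
  by rewrite ltr_norml => /andP[h ->]; rewrite (lt_trans (lbeta_lt hbeta)).
exists K; rewrite -exprnP; split=> //.
have wk (t : R) : lbeta beta < t < rbeta beta -> lbeta beta <= t < rbeta beta.
  by move=> /andP[h ->]; rewrite ltW.
apply: (@orbit_eq0_perturb _ (x / (- beta) ^+ K) K) => //; try exact: wk.
by rewrite mulrDl addrAC subrr add0r mul1r.
Qed.

Lemma finite_expDX x i (c : nat) : finite_exp x ->
  finite_exp (x + c%:R * (- beta) ^ i).
Proof.
move=> hx; elim: c => [|c IH]; first by rewrite mul0r addr0.
rewrite -natr1 mulrDl mul1r addrA.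
have := finite_expX i (finite_exp1D (finite_expX (- i) IH)).
by rewrite mulrDl mul1r -mulrA -expfzDr // addNr expr0z mulr1.
Qed.

Lemma finite_expD x y : finite_exp x -> finite_exp y -> finite_exp (x + y).
Proof.
move=> hx [k [/andP[h1 h2] [N hN]]].
have hy : lbeta beta <= y / (- beta) ^ k < rbeta beta by rewrite ltW.
have -> : y = \sum_(j < N) (dneg beta (y / (- beta) ^ k) j)%:~R
                * (- beta) ^ (k - j.+1%:Z).
  rewrite -{1}[y](divfK (expfz_neq0 k nb_neq0)).
  rewrite {1}(expand_dneg hbeta (y / _) N) hN mul0r addr0 mulr_suml.
  apply: eq_bigr => j _; rewrite -mulrA; congr (_ * _).
  by rewrite mulrC expfzDr // exprnP exprnN invr_expz.
elim: N {hN} => [|N IH]; first by rewrite big_ord0 addr0.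
rewrite big_ord_recr /= addrA.
(* A nonnegative digit is a natural number, so powers of [- beta] are only ever added. *)
have := dneg_ge0 hbeta N hy; case: (dneg _ _ _) => // c _.
exact: finite_expDX.
Qed.
End Addition.

(** * Finite orbits correspond to finite expansions *)

Section FinNeg.
Variables (R : realType) (beta : R).
Hypothesis hbeta : 1 < beta.

Let b_gt0 : 0 < beta. Proof. exact: lt_trans ltr01 hbeta. Qed.
Let nb_neq0 : - beta != 0. Proof. by rewrite oppr_eq0 gt_eqF. Qed.

(** The partial sums are eventually constant. The exponent is [k + 1] because the digit at position
    [k] is the coefficient of [(- beta)^-1] in [y]. *)
Lemma series_dneg y k (a : int -> int) N :
  (forall j : nat, a (k - j%:Z) = dneg beta y j) ->
  iter N (Tneg beta) y = 0 ->
  series (fun j : nat => (a (k - j%:Z))%:~R * (- beta) ^ (k - j%:Z)) @ \oo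
    --> (- beta) ^ (k + 1) * y.
Proof.
move=> ha hN; apply: cvg_near_cst; exists N => // M /= NM.
rewrite /series /= big_mkord [in RHS](expand_dneg hbeta y M).
rewrite (iterTneg_eq0 hbeta hN NM) mul0r addr0 mulr_sumr.
apply: eq_bigr => j _; rewrite ha mulrCA; congr (_ * _).
rewrite exprnP invr_expz -expfzDr //; congr (_ ^ _).
by rewrite -addn1 PoszD opprD addrACA subrr addr0.
Qed.

(** While the digits vanish, each step multiplies by [- beta], so a nonzero point would leave the
    bounded interval. *)
Lemma dneg_eq0_orbit y N : lbeta beta <= y < rbeta beta ->
  (forall j, (N <= j)%N -> dneg beta y j = 0) -> iter N (Tneg beta) y = 0.
Proof.
move=> hy h0.
have hp p : iter (p + N) (Tneg beta) y = (- beta) ^+ p * iter N (Tneg beta) y.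
  elim: p => [|p IH]; first by rewrite mul1r.
  by rewrite addSn iterTnegS h0 ?leq_addl // subr0 IH exprS mulrA.
apply/eqP/negPn/negP => t0; rewrite -normr_gt0 in t0.
have q0 : 0 < beta^-1 by rewrite invr_gt0.
have q1 : beta^-1 < 1 by rewrite invf_lt1.
have [p] := exprn_small 1 q0 q1 t0.
rewrite mulr1 exprVn -[_^-1]mul1r ltr_pdivrMr ?exprn_gt0 // ltNge => /negP; apply.
have := range_itv1 hbeta (iterTneg_range (p + N) hy).
rewrite -ltr_norml hp normrM normrX normrN (gtr0_norm b_gt0) mulrC.
exact: ltW.
Qed.

Lemma Fin_neg_finite_exp x : Fin_neg beta x -> finite_exp beta x.
Proof.
move=> [k0 _ [z [k [a [[[_ hz] [y [hy ha]]] h0]]] <-]].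
have hy' : lbeta beta <= y < rbeta beta by case/andP: hy => h ->; rewrite ltW.
have hN : iter `|k|.+1 (Tneg beta) y = 0.
  apply: dneg_eq0_orbit => // j hj; rewrite -ha h0 //; lia.
have -> : z = (- beta) ^ (k + 1) * y.
  exact: cvg_unique hz (series_dneg ha hN).
exists (k0 + (k + 1)); rewrite mulrA -expfzDr // mulrAC mulfV ?expfz_neq0 //.
by rewrite mul1r; split=> //; exists `|k|.+1.
Qed.

Lemma finite_exp_Fin_neg x : finite_exp beta x -> Fin_neg beta x.
Proof.
move=> [K [hy [N hN]]]; set y := x / _ in hy hN.
(* The first [N] digits of [y] then occupy positions [N - 1] down to 0. *)
pose k : int := N%:Z - 1.
(* The absolute value would mirror digits to positions above [k], hence the explicit 0. *)
pose a (i : int) : int := if k < i then 0 else dneg beta y `|k - i|.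
have ha (j : nat) : a (k - j%:Z) = dneg beta y j.
  rewrite /a ifF; first by congr dneg; lia.
  by apply/negbTE; rewrite -leNgt gerBl.
exists (K - N%:Z) => //; exists ((- beta) ^ (k + 1) * y).
  exists k, a; split; last first.
    move=> i i0; rewrite /a; case: ifP => // _; apply: (dneg_eq0_tail hbeta hN).
    by rewrite /k; lia.
  split; last by exists y.
  split; first by move=> i ki; rewrite /a ki.
  exact: series_dneg ha hN.
by rewrite mulrA -expfzDr // subrK subrK mulrC divfK // expfz_neq0.
Qed.

End FinNeg.

Theorem theorem5p3 (R : realType) (m n : int) (beta : R)
    (hn : 1 <= n) (hmn : n <= m) (hbeta : 1 < beta)
    (hroot : root ('X^2 - m%:~R *: 'X - (n%:~R)%:P) beta) :
  forall x y : R, Fin_neg beta x -> Fin_neg beta y -> Fin_neg beta (x + y).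
Proof.
have hquad : beta ^+ 2 = m%:~R * beta + n%:~R.
  move: hroot; rewrite /root !hornerE => /eqP h.
  by apply: subr0_eq; rewrite -h; ring.
move=> x y /(Fin_neg_finite_exp hbeta) hx /(Fin_neg_finite_exp hbeta) hy.
exact/(finite_exp_Fin_neg hbeta)/(finite_expD hn hmn hbeta hquad).
Qed.
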